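(* Let $C$ be a knot-like complex over $\mathcal R=\mathbb F[W,Z]$ and let $g(C)$ denote the maximum Alexander grading of a generator of $C$. For $t=\frac mn\in(0,2]$ (with $m,n$ positive integers), let $s_0$ be any integer less than $-\frac t2 g(C)-1$ and let $s_i=s_0+\frac{i}{2n}$ for $0<i<2n$. Then $$\Upsilon_C(t)=-2\min\left\{\, s_i+V_{\mathrm{SC}(t,s_i)}(C)\,\right\}_{i=0}^{2n-1}.$$ Moreover, we may restrict to even values of $i$ if $m$ is even.
   Context: Conventions. $\mathbb F=\mathbb F_2$, $\mathcal R=\mathbb F[W,Z]$, $\mathcal U=WZ$. Complexes over $\mathcal R$ carry a bigrading $(\mathrm{gr}_w,\mathrm{gr}_z)$ by integers with $\mathrm{gr}_w\equiv \mathrm{gr}_z \pmod 2$; $W$ and $Z$ have bidegrees $(-2,0)$ and $(0,-2)$, and $\partial$ has bidegree $(-1,-1)$. The Alexander grading is $A=\frac{\mathrm{gr}_w-\mathrm{gr}_z}{2}$; it is preserved by $\partial$. The vertical complex is obtained by setting $Z=1$ (it is a complex over $\mathbb F[W]$ graded by $\mathrm{gr}_w$); the horizontal complex is obtained by setting $W=1$ (a complex over $\mathbb F[Z]$ graded by $\mathrm{gr}_z$). A free, finitely generated bigraded chain complex $C$ over $\mathcal R$ is a knot-like complex if its vertical and horizontal homologies are each isomorphic to a polynomial ring $\mathbb F[\mathcal U]$ in one variable, with the generator of vertical homology in $\mathrm{gr}_w=0$ and the generator of horizontal homology in $\mathrm{gr}_z=0$. Throughout, $\{x_1,\dots,x_r\}$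 is a homogeneous set of generators (basis) of $C$ over $\mathcal R$, and ''generator of $C$'' means one of the $x_i$. The invariant $\Upsilon$. For rational $t=\frac mn\in[0,2]$, the $t$-modified complex $tC$ is the complex over $\mathbb F[v^{1/n}]$ with the same generators as $C$ and with differential obtained from that of $C$ by substituting $Z=v^{t}$ and $W=v^{2-t}$. It is graded by $\mathrm{gr}_t=(1-\frac t2)\mathrm{gr}_w+\frac t2\mathrm{gr}_z$ on generators, with $v$ of degree $-1$. Its homology is a direct sum of one free summand $\mathbb F[v^{1/n}]$ (the tower) and torsion summands. $\Upsilon_C(t)$ is the grading $\mathrm{gr}_t$ of the generator of the tower (i.e. the maximal $\mathrm{gr}_t$ of a homogeneous non-torsion homology class). Staircase subcomplexes and generalized $V_s$ invariants. Let $C^-=C\otimes_{\mathbb F[Z]}\mathbb F[Z,Z^{-1}]$ and let $C^-_0$ be its summand in Alexander grading $0$. As a vector space over $\mathbb F$, $C^-_0$ has basis the elements $W^aZ^bx_i$ with $a\ge 0$, $b\in\mathbb Z$ and $A(x_i)-a+b=0$; place $W^aZ^bx_i$ at the lattice point $(-a,-b)$, so that $C^-_0$ occupies the half-lattice with $x$-coordinate $\le 0$. $C_0^-$ is a complex over $\mathbb F[\mathcal U]$ with $H_*(C_0^-)\cong\mathbb F[\mathcal U]$. Any subset of the half-lattice closed under moving left and moving down determines a subcomplex of $C^-_0$. A finite or infinite strictly increasing integer sequence $\vec s=(s_1,s_2,\dots)$ encodes such a region, bounded above by a staircase whose corners, listed from the lower right to the upper left starting from a corner with $x$-coordinate $0$,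 have ($y$-coordinate minus $x$-coordinate) equal to $s_1,s_2,\dots$; the corresponding subcomplex is denoted $C_{\vec s}$. With $v_{\vec s}:C_{\vec s}\hookrightarrow C_0^-$ the inclusion, define $$V_{\vec s}(C)=\dim_{\mathbb F}\operatorname{coker}\big(v_{\vec s,*}:H_*(C_{\vec s})\to H_*(C_0^-)\big).$$ For $0<t\le 2$ and $s\in\mathbb Q$, $\mathrm{SC}(t,s)$ denotes the sequence encoding the region of all lattice points of the half-lattice lying on or below the line of slope $1-\frac2t$ and $y$-intercept $\frac{2s}{t}$. Equivalently, $C_{\mathrm{SC}(t,s)}$ is spanned over $\mathbb F$ by the elements $W^aZ^bx_i\in C_0^-$ with $(1-\frac t2)(-a)+\frac t2(-b)\le s$.
   Formalization: The formal theorem also assumes s_0 ≤ (t/2)A(x_i) for every generator x_i. This is automatic if all A(x_i) ≥ −g(C), e.g. for symmetric Alexander gradings; without it the claim fails, e.g. ∂x_1 = W^4x_0 + Zx_2 with A = 1, −3, −4, t = 2, s_0 = −3. *)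

(* Defs.v *)
From HB Require Import structures.
From mathcomp Require Import all_boot all_order all_algebra.
From mathcomp Require Import boolp.
From mathcomp Require Import freeg mpoly.

Set Implicit Arguments.
Unset Strict Implicit.
Unset Printing Implicit Defensive.

Import Order.TTheory GRing.Theory Num.Theory.
Local Open Scope ring_scope.
Local Open Scope quotient_scope.

(* Membership in a submodule is a Prop: boundaries are not decidable here, so *)
(* quotients are formed through the classical asbool.                         *)

Record submod (A : nzRingType) (M : lmodType A) := Submod {
  submod_set :> M -> Prop;
  submod0 : submod_set 0;
  submodPZ : forall a u v,
    submod_set u -> submod_set v -> submod_set (a *: u + v)
}.

Section SubmoduleAndQuotient.
Variables (A : nzRingType) (M : lmodType A) (N : submod M).

Definition submod_mem : M -> bool := fun x => `[< N x >].

Lemma submod_mem_closed : GRing.submod_closed submod_mem.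
Proof.
split; first exact/asboolP/submod0.
by move=> a u v /asboolP Nu /asboolP Nv; apply/asboolP/submodPZ.
Qed.

HB.instance Definition _ :=
  GRing.isSubmodClosed.Build A M submod_mem submod_mem_closed.

Definition submod_zmodClosed : zmodClosed M :=
  GRing.ZmodClosed.clone M submod_mem _.

Definition subm : Type := {x : M | submod_mem x}.
HB.instance Definition _ := SubChoice.on subm.
HB.instance Definition _ := [SubChoice_isSubLmodule of subm by <:].

Definition quotm : Type := Quotient.quot submod_zmodClosed.
HB.instance Definition _ := EqQuotient.on quotm.
HB.instance Definition _ := Choice.on quotm.
HB.instance Definition _ := GRing.Zmodule.on quotm.

Definition quotm_class (x : M) : quotm := \pi_(Quotient.quot submod_zmodClosed) x.

Lemma quotm_classP x y : quotm_class x = quotm_class y <-> N (x - y).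
Proof.
rewrite /quotm_class; split=> [/eqP|h]; last apply/eqP.
  by rewrite -Quotient.idealrBE => /asboolP.
by rewrite -Quotient.idealrBE; apply/asboolP.
Qed.

Lemma quotm_ind (P : quotm -> Prop) :
  (forall x, P (quotm_class x)) -> forall q, P q.
Proof. by move=> h q; rewrite -[q]reprK; apply: h. Qed.

Lemma quotm_classD x y :
  quotm_class (x + y) = quotm_class x + quotm_class y.
Proof. exact: (raddfD \pi_(Quotient.quot submod_zmodClosed)). Qed.

Definition quotm_scale (a : A) (q : quotm) : quotm :=
  quotm_class (a *: repr q).

Lemma quotm_scaleE a x :
  quotm_scale a (quotm_class x) = quotm_class (a *: x).
Proof.
apply/quotm_classP; rewrite -scalerBr -[_ *: _]addr0.
apply: submodPZ; last exact: submod0.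
by apply/quotm_classP; rewrite /quotm_class reprK.
Qed.

Fact quotm_scaleA a b q :
  quotm_scale a (quotm_scale b q) = quotm_scale (a * b) q.
Proof. by elim/quotm_ind: q => x; rewrite !quotm_scaleE scalerA. Qed.

Fact quotm_scale1 : left_id 1 quotm_scale.
Proof. by elim/quotm_ind=> x; rewrite quotm_scaleE scale1r. Qed.

Fact quotm_scaleDr : right_distributive quotm_scale +%R.
Proof.
move=> a; elim/quotm_ind=> x; elim/quotm_ind=> y.
by rewrite -quotm_classD !quotm_scaleE scalerDr quotm_classD.
Qed.

Fact quotm_scaleDl q : {morph quotm_scale^~ q : a b / a + b}.
Proof.
move=> a b; elim/quotm_ind: q => x.
by rewrite !quotm_scaleE scalerDl quotm_classD.
Qed.

HB.instance Definition _ := GRing.Zmodule_isLmodule.Build A quotm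
  quotm_scaleA quotm_scale1 quotm_scaleDr quotm_scaleDl.

Fact quotm_class_is_linear : linear quotm_class.
Proof. by move=> a x y; rewrite quotm_classD -quotm_scaleE. Qed.
HB.instance Definition _ :=
  GRing.isLinear.Build A M quotm *:%R quotm_class quotm_class_is_linear.

End SubmoduleAndQuotient.

Definition full_submod (A : nzRingType) (M : lmodType A) : submod M :=
  @Submod A M (fun=> True) I (fun _ _ _ _ _ => I).

Section Homology.
Variables (A : nzRingType) (M : lmodType A) (d : {linear M -> M}).

Variable S : submod M.

Fact cycles0 : S 0 /\ d 0 = 0.
Proof. by split; [exact: submod0 | exact: linear0]. Qed.
Fact cyclesPZ a u v : S u /\ d u = 0 -> S v /\ d v = 0 ->
  S (a *: u + v) /\ d (a *: u + v) = 0.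
Proof.
case=> Su du [Sv dv]; split; first exact: submodPZ.
by rewrite linearP du dv scaler0 addr0.
Qed.

Definition cycles : submod M := Submod cycles0 cyclesPZ.

Fact boundaries0 : exists2 y : M, S y & val (0 : subm cycles) = d y.
Proof. by exists 0; [exact: submod0 | rewrite !linear0]. Qed.
Fact boundariesPZ a (u v : subm cycles) :
  (exists2 y, S y & val u = d y) -> (exists2 y, S y & val v = d y) ->
  exists2 y, S y & val (a *: u + v) = d y.
Proof.
case=> y Sy uy [z Sz vz]; exists (a *: y + z); first exact: submodPZ.
by rewrite !linearP /= uy vz.
Qed.

Definition boundaries : submod (subm cycles) := Submod boundaries0 boundariesPZ.

(* Homology of the subcomplex S of (M, d): the cycles of S modulo d(S).       *)
Definition homology := quotm boundaries.
HB.instance Definition _ := GRing.Lmodule.on homology.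

Definition hclass (z : subm cycles) : homology := quotm_class boundaries z.
HB.instance Definition _ := GRing.isLinear.Build A (subm cycles) homology *:%R
  hclass (quotm_class_is_linear boundaries).

End Homology.

Section InducedMap.
Variables (A : nzRingType) (M : lmodType A) (d : {linear M -> M}).
Variables S T : submod M.

(* The image of H(S) -> H(T) induced by the inclusion of a subcomplex S of T. *)
Definition in_induced_image (h : homology d T) :=
  exists2 z : subm (cycles d T), S (val z) & h = hclass z.

Fact induced_image0 : in_induced_image 0.
Proof. by exists 0; rewrite linear0 //; apply: submod0. Qed.

Fact induced_imagePZ a u v : in_induced_image u -> in_induced_image v ->
  in_induced_image (a *: u + v).
Proof.
case=> x Sx -> [y Sy ->]; exists (a *: x + y); last by rewrite linearP.
by rewrite linearP; apply: submodPZ.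
Qed.

Definition induced_image : submod (homology d T) :=
  Submod induced_image0 induced_imagePZ.

Definition coker_inclusion := quotm induced_image.
HB.instance Definition _ := GRing.Lmodule.on coker_inclusion.
End InducedMap.

Section FreeModules.
Variables (A : nzRingType) (K : choiceType).

Section Extension.
Variables (M : lmodType A) (f : K -> M).

Definition freeg_lift (x : {freeg K / A}) : M := fglift f x.

Fact freeg_lift_is_zmod_morphism : zmod_morphism freeg_lift.
Proof. exact: lift_is_additive. Qed.
HB.instance Definition _ :=
  GRing.isZmodMorphism.Build {freeg K / A} M freeg_lift
    freeg_lift_is_zmod_morphism.

Fact freeg_lift_is_scalable : scalable freeg_lift.
Proof.
move=> a x; rewrite -[in RHS](freeg_sumE x) /= [a *: x]/(fgscale a x).
rewrite /fgscale !raddf_sum; apply: eq_bigr => k _ /=.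
by rewrite /freeg_lift !liftU scalerA.
Qed.
HB.instance Definition _ :=
  GRing.isScalable.Build A {freeg K / A} M *:%R freeg_lift
    freeg_lift_is_scalable.
End Extension.

Fact freeg_span0 (P : K -> Prop) (k : K) :
  coeff k (0 : {freeg K / A}) != 0 -> P k.
Proof. by rewrite coeff0 eqxx. Qed.

Fact freeg_spanPZ (P : K -> Prop) a (u v : {freeg K / A}) :
  (forall k, coeff k u != 0 -> P k) -> (forall k, coeff k v != 0 -> P k) ->
  forall k, coeff k (a *: u + v) != 0 -> P k.
Proof.
move=> Pu Pv k; rewrite coeffD coeffZ.
have [uk0|/Pu //] := eqVneq (coeff k u) 0.
by rewrite uk0 mulr0 add0r; apply: Pv.
Qed.

Definition freeg_span (P : K -> Prop) : submod {freeg K / A} :=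
  Submod (freeg_span0 P) (@freeg_spanPZ P).

End FreeModules.

Arguments freeg_span {A K} P.

Notation FF := 'F_2.

(* F[W, Z], with W = 'X_0 and Z = 'X_1.                                       *)
Notation RWZ := {mpoly FF[2]}.

Definition Wexp (m : 'X_{1..2}) : nat := m ord0.
Definition Zexp (m : 'X_{1..2}) : nat := m ord_max.

(* A finitely generated free bigraded chain complex over F[W, Z] with its     *)
(* homogeneous basis x_0, ..., x_(r-1); row i of the matrix holds the         *)
(* coordinates of the differential of x_i.                                    *)
Record bicomplex := Bicomplex {
  rk : nat;
  grw : 'I_rk -> int;
  grz : 'I_rk -> int;
  bdiff : 'M[RWZ]_rk;
  gr_parity : forall i, (grw i = grz i %[mod 2])%Z;
  bdiff_bidegree : forall i j m, m \in msupp (bdiff i j) ->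
    grw j - (Wexp m)%:Z *+ 2 = grw i - 1 /\
    grz j - (Zexp m)%:Z *+ 2 = grz i - 1;
  bdiff_sq : bdiff *m bdiff = 0
}.

Section Invariants.
Variable C : bicomplex.
Local Notation r := (rk C).

Definition alexander (i : 'I_r) : int := ((grw i - grz i) %/ 2)%Z.

(* The default value is only reached by the zero complex.                     *)
Definition max_alexander : int :=
  \big[Order.max/head 0 (codom alexander)]_(i < r) alexander i.

(* The complex over F['X] obtained by substituting w for W and z for Z.       *)
Definition subst_WZ (w z : {poly FF}) : RWZ -> {poly FF} :=
  mmap polyC (fun k : 'I_2 => if k == ord0 then w else z).

Definition sdiff (w z : {poly FF}) : {linear 'rV[{poly FF}]_r -> 'rV_r} :=
  mulmxr (map_mx (subst_WZ w z) (bdiff C)).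

Definition scycles w z := subm (cycles (sdiff w z) (full_submod _)).
Definition shomology w z := homology (sdiff w z) (full_submod _).
Definition sclass w z (c : scycles w z) : shomology w z := hclass c.

(* v is homogeneous of degree q, where x_i has degree gr i and 'X has degree  *)
(* - e.                                                                       *)
Definition homogeneous (gr : 'I_r -> rat) (e q : rat) (v : 'rV[{poly FF}]_r) :=
  forall i k, (v 0 i)`_k != 0 -> gr i - e * k%:R = q.

(* The homology is a free rank one module over F['X] generated by a           *)
(* homogeneous class of degree 0.                                             *)
Definition homology_tower (w z : {poly FF}) (gr : 'I_r -> int) :=
  exists2 c : scycles w z,
    homogeneous (fun i => (gr i)%:~R) 2 0 (val c) &
    bijective (fun p : {poly FF} => p *: sclass c).

Definition knot_like :=
  homology_tower 'X 1 (@grw C) /\ homology_tower 1 'X (@grz C).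

(* The t-modified complex for t = m / n <= 2: with 'X = v^(1/n), the variable *)
(* Z = v^t becomes 'X^m and W = v^(2 - t) becomes 'X^(2 * n - m).             *)
Section Upsilon.
Variables m n : nat.
Let t : rat := m%:R / n%:R.

Definition gr_t (i : 'I_r) : rat :=
  (1 - t / 2) * (grw i)%:~R + t / 2 * (grz i)%:~R.

Definition tcycles := scycles 'X^(2 * n - m) 'X^m.

(* q is the degree of a homogeneous non-torsion homology class.               *)
Definition tower_degree (q : rat) :=
  exists2 c : tcycles, homogeneous gr_t n%:R^-1 q (val c) &
    forall p : {poly FF}, p *: sclass c = 0 -> p = 0.

Definition is_Upsilon (u : rat) :=
  tower_degree u /\ forall q, tower_degree q -> q <= u.

End Upsilon.

(* The F-basis W^a Z^b x_i of C (x) F[Z, Z^-1] is encoded as (a, b, i).       *)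
Definition Cminus_basis := (nat * int * 'I_r)%type.
Definition Cminus := {freeg Cminus_basis / FF}.

Definition Cminus_diff_basis (k : Cminus_basis) : Cminus :=
  let: (a, b, i) := k in
  \sum_j \sum_(m <- msupp (bdiff C i j))
    << (bdiff C i j)@_m *g ((a + Wexp m)%N, b + (Zexp m)%:Z, j) >>.

Definition Cminus_diff : {linear Cminus -> Cminus} :=
  freeg_lift Cminus_diff_basis.

Definition Cminus_alexander (k : Cminus_basis) : int :=
  let: (a, b, i) := k in alexander i - a%:Z + b.

Definition Cminus0 : submod Cminus :=
  freeg_span (fun k => Cminus_alexander k = 0).

(* X is a set of lattice points; W^a Z^b x_i is placed at (- a, - b).         *)
Definition region := int -> int -> bool.

Definition Cregion (X : region) : submod Cminus :=
  freeg_span (fun k : Cminus_basis => Cminus_alexander k = 0 /\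
    let: (a, b, i) := k in X (- a%:Z) (- b)).

(* The cokernel of H(C_X) -> H(C^-_0) has dimension d over F.                 *)
Definition is_V (X : region) (d : nat) :=
  exists f : {linear
      coker_inclusion Cminus_diff (Cregion X) Cminus0 -> 'rV[FF]_d},
    bijective f.

End Invariants.

(* The lattice points on or below the line of slope 1 - 2 / t and y-intercept *)
(* 2 s / t; the condition x <= 0 is built into Cminus_basis.                  *)
Definition SC (t s : rat) : region := fun x y =>
  y%:~R <= (1 - 2 / t) * x%:~R + 2 * s / t.

(* Main.v *)
(** Every entry of the differential is a scalar times one monomial, so setting
W = Z = 1 loses nothing: C becomes a finite-dimensional complex over F_2 with
the two filtrations gr_w and gr_t.  Vertical homology being F[U], its even
part (for the parity of gr_w) is one-dimensional and its odd part vanishes.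
Homogeneous cycles of tC of degree q correspond to cycles of this complex
supported in gr_t >= q, and they are non-torsion exactly when they do not
bound there.  A cycle of degree -2k of C_SC(t,s) is an even cycle supported in
gr_t >= -2(s + k), the bound gr_w >= -2k being automatic by the choice of s_0;
so V_SC(t,s) is the least k for which a non-bounding one exists.  Hence
Upsilon = -2 min (s + V_SC(t,s)), with s ranging over the classes of (1/2n)Z
modulo Z.  For m even, gr_t takes values in (2/n)Z on even generators, so an
odd i describes the same subcomplex as i - 1. *)

From HB Require Import structures.
Require Import Defs.
From mathcomp Require Import all_boot all_order all_algebra.
From mathcomp Require Import boolp freeg mpoly zify ring.
Import Order.TTheory GRing.Theory Num.Theory.
Local Open Scope ring_scope.

Set Implicit Arguments.
Unset Strict Implicit.
Unset Printing Implicit Defensive.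

(** * Differentials homogeneous for a weight *)

Section WeightedMatrix.
Variables (F : fieldType) (r : nat) (c : 'M[F]_r) (e : 'I_r -> 'I_r -> nat).
(* The i-th generator has degree [T i], the variable has degree [- kappa], and
   the differential has degree [- h]. *)
Variables (T : 'I_r -> int) (h : int) (kappa : nat).
Hypothesis kappa_gt0 : (0 < kappa)%N.
Hypothesis weightE : forall i j, c i j != 0 ->
  T j = T i - h + kappa%:Z * (e i j)%:Z.

Implicit Types (d : int) (i j : 'I_r) (k : nat) (p : {poly F}).
Implicit Types (u : 'rV[F]_r) (v y : 'rV[{poly F}]_r).

Definition wdiff : 'M[{poly F}]_r := \matrix_(i, j) (c i j *: 'X^(e i j)).

(** The exponent [a] for which [X^a x_i] has degree [d]. The absolute value only makes it total; it
    is meaningful when [fits d i] holds. *)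
Definition slot d i : nat := `|((T i - d) %/ kappa)%Z|%N.
Definition fits d i : bool :=
  T i == d + kappa%:Z * (slot d i)%:Z.
Definition supported d u : Prop :=
  forall i, u 0 i != 0 -> fits d i.

(** On vectors supported in degree [d], [hlift] restores the powers of the variable; it is undone by
    [hpart], which extracts the degree [d] part and sets the variable to 1. *)
Definition hlift d u : 'rV[{poly F}]_r :=
  \row_i (u 0 i *: 'X^(slot d i)).
Definition hpart d v : 'rV[F]_r :=
  \row_i (if fits d i then (v 0 i)`_(slot d i) else 0).

Lemma fitsP d i (a : nat) : T i = d + kappa%:Z * a%:Z ->
  fits d i /\ slot d i = a.
Proof.
move=> Ti; have sl : slot d i = a.
  by rewrite /slot Ti addrC addKr mulrC mulzK //; lia.
by rewrite /fits sl Ti eqxx.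
Qed.

Lemma fits_slot d i : fits d i -> T i = d + kappa%:Z * (slot d i)%:Z.
Proof. by move/eqP. Qed.

Lemma fits_diff d i j : c i j != 0 -> fits d i ->
  fits (d - h) j /\ slot (d - h) j = (slot d i + e i j)%N.
Proof.
move=> cij /fits_slot Ti; apply: fitsP.
by rewrite (weightE cij) Ti PoszD; ring.
Qed.

(** Otherwise [slot (d - h) j - e i j] would be a slot for [i]. *)
Lemma fits_diffN d i j : c i j != 0 -> ~~ fits d i -> fits (d - h) j ->
  (slot (d - h) j < e i j)%N.
Proof.
move=> cij + /fits_slot Tj; apply: contraNT; rewrite -leqNgt => le_e.
suff /fitsP[-> //] : T i = d + kappa%:Z * (slot (d - h) j - e i j)%N%:Z.
have := weightE cij; rewrite Tj -subzn // mulrBr; lia.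
Qed.

Lemma hlift_diff d u : supported d u ->
  hlift d u *m wdiff = hlift (d - h) (u *m c).
Proof.
move=> su; apply/rowP=> j; rewrite !mxE scaler_suml.
apply: eq_bigr => i _; rewrite !mxE.
have [->|cij] := eqVneq (c i j) 0; first by rewrite !(scale0r, mulr0).
have [->|/su fi] := eqVneq (u 0 i) 0; first by rewrite !(scale0r, mul0r).
have [_ ->] := fits_diff cij fi.
by rewrite -scalerAl -scalerAr scalerA exprD.
Qed.

(** Holds for arbitrary [v]: by [fits_diffN], the entries leaving a generator that does not fit
    degree [d] carry too high a power to reach degree [d - h]. *)
Lemma hpart_diff d v : hpart (d - h) (v *m wdiff) = hpart d v *m c.
Proof.
apply/rowP=> j; rewrite !mxE.
transitivity (\sum_i (if fits (d - h) j then
    (v 0 i * (c i j *: 'X^(e i j)))`_(slot (d - h) j) else 0)).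
  case: ifP => _; last by rewrite big1.
  by rewrite coef_sum; apply: eq_bigr => i _; rewrite mxE.
apply: eq_bigr => i _; rewrite mxE -scalerAr coefZ coefMXn.
have [->|cij] := eqVneq (c i j) 0; first by rewrite mul0r mulr0 if_same.
case: (boolP (fits d i)) => fi.
  by have [-> ->] := fits_diff cij fi; rewrite ltnNge leq_addl addnK mulrC.
by case: ifP => [/(fits_diffN cij fi) ->|]; rewrite ?mulr0 mul0r.
Qed.

Lemma hpartD d v v' : hpart d (v + v') = hpart d v + hpart d v'.
Proof. by apply/rowP=> i; rewrite !mxE; case: ifP; rewrite ?coefD ?addr0. Qed.

Lemma supported_hpart d v : supported d (hpart d v).
Proof. by move=> i; rewrite mxE; case: ifP; rewrite ?eqxx. Qed.

Lemma hpartK d v :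
  (forall i k, (v 0 i)`_k != 0 -> T i = d + kappa%:Z * k%:Z) ->
  hlift d (hpart d v) = v.
Proof.
move=> hv; apply/rowP=> i; rewrite !mxE; apply/polyP=> k.
rewrite coefZ coefXn; have [vk0|] := eqVneq ((v 0 i)`_k) 0.
  by rewrite vk0; case: eqP => [<-|_]; rewrite ?mulr0 // vk0 if_same mul0r.
by move/hv/fitsP => [-> ->]; rewrite eqxx mulr1.
Qed.

Lemma hliftK d u : supported d u -> hpart d (hlift d u) = u.
Proof.
move=> su; apply/rowP=> i; rewrite !mxE coefZ coefXn eqxx mulr1.
by have [->|/su ->] := eqVneq (u 0 i) 0; rewrite ?if_same.
Qed.

Lemma hpart_scale d d' p u : supported d u ->
  (forall k : nat, p`_k != 0 -> d' != d - kappa%:Z * k%:Z) ->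
  hpart d' (p *: hlift d u) = 0.
Proof.
move=> su hp; apply/rowP=> i; rewrite !mxE -scalerAr coefZ coefMXn.
case: ifP => // /fits_slot Ti'.
have [->|/su /fits_slot Ti] := eqVneq (u 0 i) 0; first by rewrite mul0r.
case: ltnP => [_|le_s]; first by rewrite mulr0.
have [->|/hp] := eqVneq p`_(slot d' i - slot d i)%N 0; first by rewrite mulr0.
by rewrite -subzn // mulrBr; lia.
Qed.

Lemma hpart_scale_shift d p u k : supported d u ->
  hpart (d - kappa%:Z * k%:Z) (p *: hlift d u) = p`_k *: u.
Proof.
move=> su; apply/rowP=> i; rewrite !mxE -scalerAr coefZ coefMXn.
have [->|/su /fits_slot Ti] := eqVneq (u 0 i) 0.
  by rewrite mul0r mulr0 if_same.
have /fitsP[-> ->] :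
    T i = d - kappa%:Z * k%:Z + kappa%:Z * (slot d i + k)%N%:Z.
  by rewrite Ti PoszD; ring.
by rewrite ltnNge leq_addr /= addKn mulrC.
Qed.

Lemma fits_shift d k i : fits d i -> fits (d - kappa%:Z * k%:Z) i /\
  slot (d - kappa%:Z * k%:Z) i = (slot d i + k)%N.
Proof. by move/fits_slot=> Ti; apply: fitsP; rewrite Ti PoszD; ring. Qed.

Lemma supported_shift d k u :
  supported d u -> supported (d - kappa%:Z * k%:Z) u.
Proof. by move=> su i /su /(fits_shift k)[]. Qed.

Lemma supportedP d a u u' :
  supported d u -> supported d u' -> supported d (a *: u + u').
Proof.
move=> su su' i; rewrite !mxE.
have [->|/su //] := eqVneq (u 0 i) 0; rewrite mulr0 add0r; exact: su'.
Qed.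

Lemma hlift_shift d k u : supported d u ->
  hlift (d - kappa%:Z * k%:Z) u = 'X^k *: hlift d u.
Proof.
move=> su; apply/rowP=> i; rewrite !mxE.
have [->|/su fi] := eqVneq (u 0 i) 0; first by rewrite !scale0r mulr0.
by rewrite (fits_shift k fi).2 -scalerAr -exprD addnC.
Qed.

(** Nonzero entries of [c] join degrees differing by [h] modulo [kappa], so with the variable set to
    1 the complex still splits along residues of [T]; this is the projection to the residue of
    [d]. *)
Definition congruent_part d u : 'rV[F]_r := 
  \row_i (if (kappa %| T i - d)%Z then u 0 i else 0).

Lemma congruent_part_mul d u :
  congruent_part (d - h) (u *m c) = congruent_part d u *m c.
Proof.
apply/rowP=> j; rewrite !mxE.
transitivity (\sum_i (if (kappa %| T j - (d - h))%Z then u 0 i * c i j else 0)).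
  by case: ifP => // _; rewrite big1.
apply: eq_bigr => i _; rewrite mxE.
have [->|cij] := eqVneq (c i j) 0; first by rewrite !mulr0 if_same.
have -> : T j - (d - h) = (T i - d) + kappa%:Z * (e i j)%:Z.
  by rewrite (weightE cij); ring.
by rewrite rpredDr ?dvdz_mulr ?dvdzz //; case: ifP; rewrite ?mul0r.
Qed.

Lemma congruent_part_id d u : supported d u -> congruent_part d u = u.
Proof.
move=> su; apply/rowP=> i; rewrite mxE.
have [->|/su /fits_slot ->] := eqVneq (u 0 i) 0; first by rewrite if_same.
by rewrite addrC addKr dvdz_mulr.
Qed.

Lemma congruent_part_supported d u :
  exists k0 : nat, supported (d - kappa%:Z * k0%:Z) (congruent_part d u).
Proof.
(* A power at least every [|T i - d|] makes room for all congruent generators at once. *)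
exists (\sum_i `|T i - d|)%N => i; rewrite mxE.
case: ifP; last by rewrite eqxx.
case/dvdzP=> a Ea _; set K := (\sum_i _)%N.
have aK : (`|T i - d| <= K)%N by rewrite /K (bigD1 i) //= leq_addr.
have a0 : 0 <= a + K%:Z by nia.
have /fitsP[] // :
    T i = d - kappa%:Z * K%:Z + kappa%:Z * (`|(a + K%:Z)%R|%N)%:Z.
by rewrite gez0_abs // -[T i](subrK d) Ea; ring.
Qed.

(** Torsion dies exactly when the variable is inverted, and within one residue class this amounts to
    setting the variable to 1. *)
Lemma hlift_torsion d u : supported d u ->
  (u <= c)%MS <->
  exists2 p : {poly F}, p != 0 & exists y, p *: hlift d u = y *m wdiff.
Proof.
move=> su; split=> [/submxP[y uy]|[p p0 [y py]]].
  (* A preimage under [c] may mix residues and involve generators of too low degree: project it to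
     the residue of [d + h], then multiply by a power of the variable. *)
  have [k sy] := congruent_part_supported (d + h) y.
  exists 'X^k; first by rewrite -size_poly_eq0 size_polyXn.
  exists (hlift (d + h - kappa%:Z * k%:Z) (congruent_part (d + h) y)).
  rewrite hlift_diff // -congruent_part_mul addrK -uy congruent_part_id //.
  have -> : d + h - kappa%:Z * k%:Z - h = d - kappa%:Z * k%:Z by ring.
  by rewrite hlift_shift.
have pk : p`_(size p).-1 != 0 by rewrite -lead_coefE lead_coef_eq0.
apply/submxP; exists ((p`_(size p).-1)^-1 *:
  hpart (d - kappa%:Z * (size p).-1%:Z + h) y).
rewrite -scalemxAl -hpart_diff addrK -py hpart_scale_shift // scalerA.
by rewrite mulVf // scale1r.
Qed.
End WeightedMatrix.

(** * The differential at W = Z = 1 *)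

Section MonomialForm.
Variable C : bicomplex.
Local Notation r := (rk C).

Definition dcoef : 'M[FF]_r := \matrix_(i, j) (bdiff C i j).@[fun=> 1].
Definition dmon (i j : 'I_r) : 'X_{1..2} := head 0%MM (msupp (bdiff C i j)).
Definition wexp i j := Wexp (dmon i j).
Definition zexp i j := Zexp (dmon i j).

(** The bidegrees of [x_i] and [x_j] determine both exponents, so an entry has at most one
    monomial. *)
Lemma mem_msupp_bdiff i j mo : mo \in msupp (bdiff C i j) -> mo = dmon i j.
Proof.
move=> mo_in; have mon_in : dmon i j \in msupp (bdiff C i j).
  by move: mo_in; rewrite /dmon; case: (msupp _) => //= *; rewrite mem_head.
have [] := bdiff_bidegree mo_in; have [] := bdiff_bidegree mon_in.
rewrite /Wexp /Zexp => w1 z1 w2 z2; apply/mnmP=> -[[|[|//]] lt_k].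
  by rewrite (_ : Ordinal lt_k = ord0); [lia | exact/val_inj].
by rewrite (_ : Ordinal lt_k = ord_max); [lia | exact/val_inj].
Qed.

Lemma msupp_bdiff i j :
  msupp (bdiff C i j) = if dcoef i j == 0 then [::] else [:: dmon i j].
Proof.
have uq := msupp_uniq (bdiff C i j).
rewrite mxE mevalE; case E: (msupp _) uq => [|mo s] uq.
  by rewrite big_nil eqxx.
case: s E uq => [|mo' s] E uq; last first.
  have m1 : mo = dmon i j by apply: mem_msupp_bdiff; rewrite E mem_head.
  have m2 : mo' = dmon i j.
    by apply: mem_msupp_bdiff; rewrite E !inE eqxx orbT.
  by move: uq; rewrite m1 m2 /= mem_head.
have -> : dmon i j = mo by rewrite /dmon E.
rewrite big_seq1 big1 ?mulr1; last by move=> k _; rewrite expr1n.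
have : mo \in msupp (bdiff C i j) by rewrite E mem_head.
by rewrite mcoeff_msupp => /negbTE->.
Qed.

Lemma mcoeff_bdiff i j : (bdiff C i j)@_(dmon i j) = dcoef i j.
Proof.
have [d0|dn0] := eqVneq (dcoef i j) 0.
  rewrite d0; apply/eqP; have := msupp_bdiff i j.
  by rewrite d0 eqxx mcoeff_eq0 => ->.
rewrite mxE mevalE msupp_bdiff (negbTE dn0) big_seq1 big1 ?mulr1 //.
by move=> k _; rewrite expr1n.
Qed.

Lemma grw_diff i j : dcoef i j != 0 ->
  grw j = grw i - 1 + 2%:Z * (wexp i j)%:Z.
Proof.
move=> dn0; have mon_in : dmon i j \in msupp (bdiff C i j).
  by rewrite msupp_bdiff (negbTE dn0) mem_head.
by have [+ _] := bdiff_bidegree mon_in; rewrite /wexp; lia.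
Qed.

Lemma grz_diff i j : dcoef i j != 0 ->
  grz j = grz i - 1 + 2%:Z * (zexp i j)%:Z.
Proof.
move=> dn0; have mon_in : dmon i j \in msupp (bdiff C i j).
  by rewrite msupp_bdiff (negbTE dn0) mem_head.
by have [_ +] := bdiff_bidegree mon_in; rewrite /zexp; lia.
Qed.

Lemma grw_grz (i : 'I_r) : grw i - grz i = 2%:Z * alexander i.
Proof. by have := gr_parity i; rewrite /alexander; lia. Qed.

Lemma alexander_diff i j : dcoef i j != 0 ->
  alexander j = alexander i + (wexp i j)%:Z - (zexp i j)%:Z.
Proof.
move=> dn0; have := grw_diff dn0; have := grz_diff dn0.
by have := grw_grz i; have := grw_grz j; lia.
Qed.

Lemma subst_bdiff (w z : {poly FF}) i j :
  subst_WZ w z (bdiff C i j) = dcoef i j *: (w ^+ wexp i j * z ^+ zexp i j).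
Proof.
rewrite /subst_WZ /mmap msupp_bdiff.
case: eqP => [->|_]; first by rewrite big_nil scale0r.
rewrite big_seq1 mcoeff_bdiff mul_polyC; congr (_ *: _).
rewrite /mmap1 big_ord_recl big_ord1 /wexp /zexp /Wexp /Zexp /=.
by rewrite (_ : fintype.lift ord0 ord0 = ord_max) //; apply: val_inj.
Qed.

Lemma subst_vertical : map_mx (subst_WZ 'X 1) (bdiff C) = wdiff dcoef wexp.
Proof.
by apply/matrixP=> i j; rewrite [LHS]mxE [RHS]mxE subst_bdiff expr1n mulr1.
Qed.

Lemma scycle_diff w z (c : scycles C w z) :
  val c *m map_mx (subst_WZ w z) (bdiff C) = 0.
Proof. by have /asboolP [] := valP c. Qed.

Lemma scycle_exists w z (v : 'rV[{poly FF}]_r) :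
  v *m map_mx (subst_WZ w z) (bdiff C) = 0 ->
  exists c : scycles C w z, val c = v.
Proof.
move=> dv; have vP : submod_mem (cycles (sdiff C w z) (full_submod _)) v.
  exact/asboolP.
by exists (Sub v vP); rewrite SubK.
Qed.

Lemma sclass_eq0 w z (c : scycles C w z) :
  sclass c = 0 <-> exists y, val c = y *m map_mx (subst_WZ w z) (bdiff C).
Proof.
rewrite /sclass -(linear0 (@hclass _ _ (sdiff C w z) (full_submod _))).
rewrite /hclass quotm_classP subr0.
by split=> [[y _ ->]|[y cy]]; exists y.
Qed.

Local Notation even_supported := (supported (@grw C) 2).

(** The working form of the vertical tower at [W = Z = 1]: [u0] generates it, and a cycle supported
    in degree [d] has a tower part only if [d] is 0, -2, -4, ... *)
Lemma vertical_generator : knot_like C -> exists u0 : 'rV[FF]_r,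
  [/\ u0 *m dcoef = 0, ~~ (u0 <= dcoef)%MS, even_supported 0 u0 &
  forall d u, u *m dcoef = 0 -> even_supported d u ->
    exists l : FF, exists y, [/\ u = l *: u0 + y *m dcoef,
      even_supported (d + 1) y &
      l != 0 -> exists k : nat, d = - (2%:Z * k%:Z)]].
Proof.
case=> -[c hc [g gK Kg]] _; have wE := grw_diff.
have cc : val c *m wdiff dcoef wexp = 0.
  by move: (scycle_diff c); rewrite -subst_vertical.
have hc' i k : (val c 0 i)`_k != 0 -> grw i = 0 + 2%:Z * k%:Z.
  by move/hc => /eqP; rewrite subr_eq0 add0r -(intrM _ 2 k) eqr_int => /eqP.
have cE : hlift (@grw C) 2 0 (hpart (@grw C) 2 0 (val c)) = val c.
  exact: hpartK.
set u0 := hpart _ _ _ _ in cE; exists u0.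
have su0 : even_supported 0 u0 by exact: supported_hpart.
split=> //.
- rewrite /u0 -(hpart_diff (h := 1) _ wE) //.
  by rewrite cc; apply/rowP=> i; rewrite !mxE coef0 if_same.
(* Were [u0] a boundary, some [p != 0] would kill the class of [c], against injectivity of
   multiplication on that class. *)
- apply/negP=> /(hlift_torsion _ wE su0) [] // p p0 [y]; rewrite cE => py.
  have : p *: sclass c = 0 *: sclass c.
    rewrite scale0r -linearZ; apply/sclass_eq0; exists y.
    by rewrite subst_vertical.
  by move/(can_inj gK)=> pE; rewrite pE eqxx in p0.
move=> d u uc su; have duc : hlift (@grw C) 2 d u *m wdiff dcoef wexp = 0.
  rewrite (hlift_diff _ wE su) // uc; apply/rowP=> i.
  by rewrite !mxE scale0r.
have [|z zE'] := @scycle_exists 'X 1 (hlift (@grw C) 2 d u).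
  by rewrite subst_vertical.
(* The coordinate of the class of [z] along the generator. The degree [d] part of [p *: c] is
   [p_k u0] if [d = -2k], and 0 if [d] has no such form. *)
pose p := g (sclass z).
have : sclass (z - p *: c) = 0.
  by rewrite /sclass linearB linearZ /= -[hclass c]/(sclass c) Kg subrr.
case/sclass_eq0=> y.
rewrite subst_vertical linearB linearZ /= zE' scalerN => zE.
have uE : u = hpart (@grw C) 2 d (p *: val c) +
              hpart (@grw C) 2 (d + 1) y *m dcoef.
  rewrite -(hpart_diff _ wE) // addrK -zE -hpartD addrC subrK.
  by rewrite (hliftK (T := @grw C) (kappa := 2)).
have [[k pk dE]|np] :=
  pselect (exists2 k : nat, p`_k != 0 & d = 0 - 2%:Z * k%:Z).
  exists p`_k, (hpart (@grw C) 2 (d + 1) y); split=> //; last by exists k; lia.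
    rewrite {1}uE; congr (_ + _); rewrite dE -cE hpart_scale_shift //.
  exact: supported_hpart.
exists 0, (hpart (@grw C) 2 (d + 1) y); split=> //.
  rewrite scale0r add0r {1}uE -cE (hpart_scale _ su0) ?add0r // => k pk.
  by apply/eqP=> dE; apply: np; exists k.
exact: supported_hpart.
Qed.

End MonomialForm.

(** * Tower classes of the t-modified complex *)

Section TowerDegree.
Variables (C : bicomplex) (m n : nat).
Hypotheses (hn : (0 < n)%N) (hmn : (m <= 2 * n)%N).
Local Notation even_supported := (supported (@grw C) 2).

(* [n] times the grading [gr_t]. *)
Definition twt (i : 'I_(rk C)) : int := n%:Z * grw i - m%:Z * alexander i.
Definition texp i j : nat :=
  ((2 * n - m) * wexp (C := C) i j + m * zexp (C := C) i j)%N.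

Lemma twt_diff i j : dcoef C i j != 0 ->
  twt j = twt i - n%:Z + 1%N%:Z * (texp i j)%:Z.
Proof.
move=> dn0; rewrite /twt /texp (grw_diff dn0) (alexander_diff dn0).
by rewrite PoszD !PoszM -subzn // PoszM; ring.
Qed.

(** The variable has degree -1 for [twt], so there is no congruence condition. *)
Lemma twt_supported Q (u : 'rV[FF]_(rk C)) :
  supported twt 1 Q u <-> forall i, u 0 i != 0 -> Q <= twt i.
Proof.
split=> su i /su; first by move/fits_slot; lia.
move=> leQ; have /fitsP[] // : twt i = Q + 1%N%:Z * `|(twt i - Q)%R|%N%:Z.
by rewrite mul1r gez0_abs ?subr_ge0 // addrC subrK.
Qed.

Lemma subst_modified :
  map_mx (subst_WZ 'X^(2 * n - m) 'X^m) (bdiff C) = wdiff (dcoef C) texp.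
Proof.
apply/matrixP=> i j; rewrite [LHS]mxE [RHS]mxE subst_bdiff /texp.
by rewrite exprD !exprM.
Qed.

(** Since [gr_w - gr_z = 2 A], the grading [gr_t] equals [gr_w - t A]. *)
Lemma gr_tE i : gr_t m n i = (twt i)%:~R / n%:R.
Proof.
have n0 : n%:R != 0 :> rat by rewrite pnatr_eq0; lia.
have -> : twt i = n%:Z * grw i - m%:Z * alexander i by [].
have := grw_grz i => /(congr1 (fun x : int => x%:~R : rat)).
rewrite /gr_t rmorphB !rmorphM /= => E.
have -> : (grz i)%:~R = (grw i)%:~R - 2 * (alexander i)%:~R :> rat.
  by rewrite -E; ring.
by rewrite rmorphB !rmorphM /=; field.
Qed.

(** Setting the variable to 1 turns a homogeneous cycle of degree [q] into one supported in
    [gr_t >= q]; by [hlift_torsion], non-torsion becomes non-bounding. *)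
Lemma tower_degreeP q : tower_degree C m n q <->
  exists Q : int, exists u : 'rV[FF]_(rk C), [/\ q = Q%:~R / n%:R,
    u *m dcoef C = 0, ~~ (u <= dcoef C)%MS &
    forall i, u 0 i != 0 -> Q <= twt i].
Proof.
have n0 : n%:R != 0 :> rat by rewrite pnatr_eq0; lia.
have tE := twt_diff; split=> [[c hc ntc]|[Q [u [-> uc nb /twt_supported su]]]].
  (* The zero class is torsion, so some monomial occurs in [c]; its degree shows that [n q] is an
     integer. *)
  have [i [k vk]] : exists i, exists k, (val c 0 i)`_k != 0.
    apply: contrapT => v0.
    suff /ntc/eqP : 1 *: sclass c = 0 by rewrite oner_eq0.
    rewrite scale1r; apply/sclass_eq0; exists 0; rewrite mul0mx.
    apply/rowP=> i; rewrite mxE; apply/polyP=> k; rewrite coef0.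
    by apply: contrapT => vk; apply: v0; exists i, k; apply/eqP.
  have hT j l : (val c 0 j)`_l != 0 -> twt j = (twt i - k%:Z) + 1%N%:Z * l%:Z.
    move/hc; rewrite -(hc _ _ vk) !gr_tE => E.
    have {}E : ((twt j)%:~R - l%:R) / n%:R = ((twt i)%:~R - k%:R) / n%:R :> rat.
      by move: E; rewrite !mulrBl ![_^-1 * _]mulrC.
    move/(mulIf (invr_neq0 n0)): E.
    by rewrite !pmulrn -!rmorphB /= => /intr_inj; lia.
  have vE := hpartK (ltn0Sn 0) hT; set u := hpart _ _ _ _ in vE.
  have su : supported twt 1 (twt i - k%:Z) u by exact: supported_hpart.
  have cc := scycle_diff c; rewrite subst_modified in cc.
  exists (twt i - k%:Z), u; split.
  - by rewrite -(hc _ _ vk) gr_tE intrB -pmulrn; field.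
  - rewrite /u -(hpart_diff (ltn0Sn 0) tE) cc; apply/rowP=> j.
    by rewrite !mxE coef0 if_same.
  - apply/negP=> /(hlift_torsion (ltn0Sn 0) tE su)[p p0 [y]]; rewrite vE => py.
    have pc : p *: sclass c = 0.
      rewrite -linearZ; apply/sclass_eq0; exists y.
      by rewrite subst_modified.
    by rewrite (ntc _ pc) eqxx in p0.
  - exact/twt_supported.
have [|c cE] := @scycle_exists C 'X^(2 * n - m) 'X^m (hlift twt 1 Q u).
  rewrite subst_modified (hlift_diff (ltn0Sn 0) tE su) uc; apply/rowP=> i.
  by rewrite !mxE scale0r.
exists c => [i k|p].
  rewrite cE mxE coefZ coefXn; have [->|/su fi] := eqVneq (u 0 i) 0.
    by rewrite mul0r eqxx.
  have [kE _|_] := eqVneq k (slot twt 1 Q i); last by rewrite mulr0 eqxx.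
  by rewrite gr_tE (fits_slot fi) -kE mul1r intrD -pmulrn; field.
rewrite -linearZ => /sclass_eq0[y]; rewrite linearZ /= cE subst_modified => py.
apply: contrapT => /eqP p0; case/negP: nb.
apply/(hlift_torsion (ltn0Sn 0) tE su).
by exists p => //; exists y.
Qed.

End TowerDegree.

(** * Reduction to cycles of even degree *)

Section Parity.
Variable C : bicomplex.
Hypothesis hC : knot_like C.
Local Notation even_supported := (supported (@grw C) 2).

(** Outside the degrees 0, -2, -4, ... the tower coefficient vanishes; this covers positive even
    degrees as well as odd ones. *)
Lemma odd_cycle_boundary u d : u *m dcoef C = 0 -> even_supported d u ->
  (forall k : nat, d != - (2%:Z * k%:Z)) -> (u <= dcoef C)%MS.
Proof.
move=> uc su dk; have [u0 [_ _ _ /(_ d u uc su)[l [y [uE _ hl]]]]] :=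
  vertical_generator hC.
have [l0|/hl[k /eqP]] := eqVneq l 0; last by rewrite (negbTE (dk k)).
by rewrite uE l0 scale0r add0r submxMl.
Qed.

(** The odd part is itself a cycle, hence bounds. Dropping it only removes coordinates, so lower
    bounds on [gr_t] over the support survive. *)
Lemma even_part_cycle u : u *m dcoef C = 0 -> ~~ (u <= dcoef C)%MS ->
  congruent_part (@grw C) 2 0 u *m dcoef C = 0 /\
  ~~ (congruent_part (@grw C) 2 0 u <= dcoef C)%MS.
Proof.
move=> uc nb; have wE := @grw_diff C.
have cp d : congruent_part (@grw C) 2 d u *m dcoef C = 0.
  rewrite -(congruent_part_mul wE) uc; apply/rowP=> i.
  by rewrite !mxE if_same.
split; first exact: cp.
have uE : u = congruent_part (@grw C) 2 0 u + congruent_part (@grw C) 2 1 u.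
  apply/rowP=> i; rewrite !mxE.
  have := erefl (2 %| grw i - 0)%Z; case: {2 3}(_ %| _)%Z => d0;
    case: (boolP (2 %| grw i - 1)%Z) => d1; rewrite ?addr0 ?add0r //; lia.
have [k0 s1] := congruent_part_supported (@grw C) (ltn0Sn 1) 1 u.
apply: contra nb => b0; rewrite uE addmx_sub //.
by apply: odd_cycle_boundary s1 _ => // k; lia.
Qed.

End Parity.

(** * The cokernel defining V *)

Section QuotientMaps.
Variables (A : nzRingType) (M W : lmodType A) (N : submod M).
Variables (f : {linear M -> W}).

Lemma quotm_lift : (forall x, N x -> f x = 0) ->
  exists g : {linear quotm N -> W}, forall x, g (quotm_class N x) = f x.
Proof.
move=> fN; pose g (q : quotm N) := f (repr q).
have gE x : g (quotm_class N x) = f x.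
  apply/eqP; rewrite -subr_eq0 -linearB; apply/eqP/fN.
  by apply/quotm_classP; rewrite /quotm_class reprK.
have g_lin : linear g.
  move=> a; elim/quotm_ind=> x; elim/quotm_ind=> y.
  by rewrite -linearP !gE linearP.
by exists (HB.pack_for {linear quotm N -> W} g
  (GRing.isLinear.Build _ _ _ _ g g_lin)).
Qed.

Lemma quotm_iso :
  (forall x, f x = 0 <-> N x) -> (forall w, exists x, f x = w) ->
  exists g : {linear quotm N -> W}, bijective g.
Proof.
move=> fN f_surj; have [x /fN //|g gE] := quotm_lift.
exists g; have [s sK] := choice f_surj.
exists (fun w => quotm_class N (s w)) => [|w]; last by rewrite gE sK.
elim/quotm_ind=> x; apply/quotm_classP/fN.
by rewrite linearB sK gE subrr.
Qed.

End QuotientMaps.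

Section FreeModuleMaps.
Variables (A : nzRingType) (K : choiceType).

Lemma scale_freegU a k :
  << a *g k >> = a *: << k >> :> {freeg K / A}.
Proof.
by apply/eqP/freeg_eqP=> k'; rewrite coeffZ !coeffU mul1r.
Qed.

Lemma freeg_linear_eq (V : lmodType A)
    (f g : {linear {freeg K / A} -> V}) :
  (forall k, f << k >> = g << k >>) -> f =1 g.
Proof.
move=> fg x; rewrite -(freeg_sumE x) !linear_sum; apply: eq_bigr => k _.
by rewrite scale_freegU !linearZ fg.
Qed.

End FreeModuleMaps.

(** * Homogeneous components of the complex in Alexander grading 0 *)

Section Components.
Variable C : bicomplex.
Local Notation r := (rk C).
Local Notation even_supported := (supported (@grw C) 2).
Local Notation slot := (slot (@grw C) 2).
Local Notation d := (Cminus_diff C).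
Implicit Types (delta : int) (u : 'rV[FF]_r) (x : Cminus C).

(** As [Z] has [gr_w] degree 0, [W^a Z^b x_i] has degree [grw i - 2a]. In Alexander grading 0, [a]
    determines [b], so within one degree recording [x_i] alone loses nothing. *)
Definition component_basis (delta : int) (k : Cminus_basis C) : 'rV[FF]_r :=
  let: (a, b, i) := k in
  if (grw i - 2%:Z * a%:Z == delta) && (Cminus_alexander k == 0)
  then delta_mx 0 i else 0.

Definition component (delta : int) : {linear Cminus C -> 'rV[FF]_r} :=
  freeg_lift (component_basis delta).

(** The exponent of [Z] is the one forced by Alexander grading 0. *)
Definition slot_basis delta i : Cminus_basis C :=
  (slot delta i, (slot delta i)%:Z - alexander i, i).

Definition inclusion (delta : int) (u : 'rV[FF]_r) : Cminus C :=
  \sum_i u 0 i *: << slot_basis delta i >>.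

Lemma component_freegU delta k :
  component delta << k >> = component_basis delta k.
Proof. by rewrite /component /= /freeg_lift liftU scale1r. Qed.

Lemma Cminus_diff_freegU a b i : d << (a, b, i) >> =
  \sum_j dcoef C i j *:
    << ((a + wexp i j)%N, b + (zexp i j)%:Z, j) : Cminus_basis C >>.
Proof.
rewrite /= /freeg_lift liftU scale1r; apply: eq_bigr => j _.
rewrite msupp_bdiff; case: eqP => [->|_]; first by rewrite big_nil scale0r.
by rewrite big_seq1 mcoeff_bdiff scale_freegU.
Qed.

Lemma component_diff delta x :
  component (delta - 1) (d x) = component delta x *m dcoef C.
Proof.
apply: (@freeg_linear_eq _ _ _ (component (delta - 1) \o d)
  (mulmxr (dcoef C) \o component delta)) => -[[a b] i] /=.
rewrite -/(d _) Cminus_diff_freegU -/(component _ _) linear_sum.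
rewrite -/(component _ _) component_freegU.
transitivity (\sum_j (if (grw i - 2%:Z * a%:Z == delta) &&
    (alexander i - a%:Z + b == 0) then dcoef C i j *: delta_mx 0 j else 0)
    : 'rV[FF]_r).
  apply: eq_bigr => j _; rewrite linearZ_LR component_freegU /=.
  have [->|dn0] := eqVneq (dcoef C i j) 0; first by rewrite !scale0r if_same.
  have wE := grw_diff dn0; have aE := alexander_diff dn0.
  have -> : (grw j - 2%:Z * (a + wexp i j)%N%:Z == delta - 1) =
      (grw i - 2%:Z * a%:Z == delta) by lia.
  have -> : (alexander j - (a + wexp i j)%N%:Z + (b + (zexp i j)%:Z) == 0) =
      (alexander i - a%:Z + b == 0) by lia.
  by case: ifP; rewrite ?scaler0.
rewrite /component_basis /Cminus_alexander; case: ifP => _; last first.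
  by rewrite big1 // mul0mx.
rewrite -rowE [RHS]row_sum_delta; apply: eq_bigr => j _.
by rewrite [in RHS]mxE.
Qed.

Lemma component_neq0 delta x i : component delta x 0 i != 0 ->
  exists a b, [/\ coeff (a, b, i) x != 0, grw i - 2%:Z * a%:Z = delta &
    Cminus_alexander (a, b, i) = 0].
Proof.
move=> xi; apply: contrapT => nx; case/negP: xi.
rewrite -(freeg_sumE x) linear_sum summxE big1_seq // => -[[a b] j] /=.
rewrite mem_dom => xj; rewrite scale_freegU linearZ_LR component_freegU mxE.
rewrite /component_basis; case: ifP; last by rewrite mxE mulr0.
case/andP=> /eqP deg /eqP al; rewrite mxE.
have [ij|] := eqVneq i j; last by rewrite andbF mulr0.
by case: nx; exists a, b; rewrite ij.
Qed.

Lemma component_supported delta x : even_supported delta (component delta x).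
Proof.
move=> i /component_neq0[a [b [_ deg _]]].
by have [] := @fitsP _ (@grw C) 2 isT delta i a; [lia|].
Qed.

Lemma slot_basis_deg delta i : fits (@grw C) 2 delta i ->
  grw i - 2%:Z * (slot delta i)%:Z = delta.
Proof. by move/fits_slot; lia. Qed.

Lemma slot_basis_alexander delta i :
  Cminus_alexander (slot_basis delta i) = 0.
Proof. by rewrite /Cminus_alexander /=; ring. Qed.

Lemma inclusion_is_linear delta : linear (inclusion delta).
Proof.
move=> a u v; rewrite /inclusion scaler_sumr -big_split /=.
by apply: eq_bigr => i _; rewrite !mxE scalerDl scalerA.
Qed.
HB.instance Definition _ delta := GRing.isLinear.Build FF 'rV[FF]_r (Cminus C)
  *:%R (inclusion delta) (inclusion_is_linear delta).

Lemma inclusion_diff delta u : even_supported delta u ->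
  d (inclusion delta u) = inclusion (delta - 1) (u *m dcoef C).
Proof.
move=> su; rewrite /inclusion linear_sum.
transitivity (\sum_i \sum_j (u 0 i * dcoef C i j) *:
    << slot_basis (delta - 1) j >> : Cminus C).
  apply: eq_bigr => i _; rewrite linearZ_LR Cminus_diff_freegU scaler_sumr.
  apply: eq_bigr => j _; rewrite scalerA.
  have [->|dn0] := eqVneq (dcoef C i j) 0; first by rewrite mulr0 !scale0r.
  have [->|/su fi] := eqVneq (u 0 i) 0; first by rewrite mul0r !scale0r.
  have [_ sE] := fits_diff (ltn0Sn 1) (@grw_diff C) dn0 fi.
  rewrite /slot_basis sE (alexander_diff dn0) PoszD.
  by congr (_ *: << (_, _, _) >>); ring.
rewrite exchange_big; apply: eq_bigr => j _.
by rewrite -scaler_suml mxE.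
Qed.

Lemma component_inclusion delta delta' u : even_supported delta u ->
  component delta' (inclusion delta u) = if delta' == delta then u else 0.
Proof.
move=> su; rewrite /inclusion linear_sum.
transitivity (\sum_i (if delta' == delta then u 0 i *: delta_mx 0 i else 0)
  : 'rV[FF]_r).
  apply: eq_bigr => i _; rewrite linearZ_LR component_freegU.
  have [->|/su fi] := eqVneq (u 0 i) 0; first by rewrite !scale0r if_same.
  rewrite /component_basis slot_basis_alexander /= slot_basis_deg // eqxx andbT.
  by rewrite eq_sym; case: ifP; rewrite ?scaler0.
by case: ifP => _; [rewrite -row_sum_delta | rewrite big1].
Qed.

Lemma inclusion_span (P : Cminus_basis C -> Prop) delta u :
  (forall i, u 0 i != 0 -> P (slot_basis delta i)) ->
  freeg_span P (inclusion delta u).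
Proof.
move=> uP k; rewrite /inclusion raddf_sum /= => k0; apply: contrapT => nP.
case/negP: k0; rewrite big1 // => i _; rewrite coeffZ coeffU mul1r.
have [->|/uP Pi] := eqVneq (u 0 i) 0; first by rewrite mul0r.
by case: eqP => [E|_]; [case: nP; rewrite -E | rewrite mulr0].
Qed.

Lemma inclusion_Cminus0 delta u : Cminus0 C (inclusion delta u).
Proof. by apply: inclusion_span => i _; apply: slot_basis_alexander. Qed.

Definition basis_degree (k : Cminus_basis C) : int :=
  grw k.2 - 2%:Z * (k.1.1)%:Z.

Lemma component_decomposition x : Cminus0 C x -> exists s : seq int,
  x = \sum_(delta <- s) inclusion delta (component delta x).
Proof.
(* Degrees are listed without repetition, so that each basis element is counted once. *)
move=> x0; exists (undup [seq basis_degree k | k <- dom x]).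
rewrite -{1}(freeg_sumE x).
transitivity (\sum_(k <- dom x)
    \sum_(delta <- undup [seq basis_degree k | k <- dom x])
      inclusion delta (coeff k x *: component_basis delta k)); last first.
  rewrite exchange_big; apply: eq_bigr => delta _.
  rewrite -linear_sum; congr (inclusion _ _).
  rewrite -[in RHS](freeg_sumE x) linear_sum; apply: eq_bigr => k _.
  by rewrite scale_freegU linearZ_LR component_freegU.
apply: eq_big_seq => k k_dom.
have := x0 k; rewrite -mem_dom => /(_ k_dom) alk.
rewrite (big_rem (basis_degree k)) /=; last by rewrite mem_undup map_f.
rewrite big1_seq ?addr0 => [|delta /andP[_]]; last first.
  rewrite rem_filter ?undup_uniq // mem_filter => /andP[/= ne _].
  case: k {k_dom} alk ne => [[a b] i] alk ne.
  by rewrite /component_basis [_ == delta]eq_sym (negbTE ne) scaler0 linear0.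
case: k {k_dom} alk => [[a b] i] alk.
rewrite /component_basis alk /basis_degree !eqxx /= linearZ_LR scale_freegU.
congr (_ *: _); rewrite /= /inclusion (bigD1 i) //= big1 => [|j ne]; last first.
  by rewrite mxE (negbTE ne) andbF scale0r.
rewrite mxE !eqxx scale1r addr0 /slot_basis.
have [|_ ->] := @fitsP r (@grw C) 2 isT (grw i - 2%:Z * a%:Z) i a.
  by rewrite subrK.
by move: alk; rewrite /Cminus_alexander => alk; congr << (_, _, _) >>; lia.
Qed.

(** * The cokernel for a half-plane region *)

Section Cokernel.
Variables (m n : nat) (S : int) (u0 : 'rV[FF]_r) (X : region).
Hypotheses (u0_cycle : u0 *m dcoef C = 0) (u0_supp : even_supported 0 u0).
Hypothesis u0_gen : forall delta u,
  u *m dcoef C = 0 -> even_supported delta u ->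
  exists l : FF, exists y, [/\ u = l *: u0 + y *m dcoef C,
    even_supported (delta + 1) y &
    l != 0 -> exists k : nat, delta = - (2%:Z * k%:Z)].
Hypothesis XE : forall (a : nat) b i, Cminus_alexander (a, b, i) = 0 ->
  X (- a%:Z) (- b) = (m%:Z * alexander (i : 'I_r) <= 2%:Z * n%:Z * a%:Z + S).

(* [phi] detects the tower: on even cycles it vanishes exactly on boundaries. *)
Variable phi : 'cV[FF]_r.
Hypotheses (phi_bnd : dcoef C *m phi = 0) (phi_u0 : (u0 *m phi) 0 0 != 0).

(* [u] stands for an element of degree [- 2k] of the subcomplex
   [C_SC(m / n, S / 2n)]. *)
Definition below_line (u : 'rV[FF]_r) (k : nat) :=
  [/\ u *m dcoef C = 0, ~~ (u <= dcoef C)%MS,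
      even_supported (- (2%:Z * k%:Z)) u &
      forall i, u 0 i != 0 -> - (S + 2%:Z * n%:Z * k%:Z) <= twt m n i].

Variable V : nat.
Hypotheses (V_attained : exists u, below_line u V)
  (V_min : forall k, (k < V)%N -> ~ exists u, below_line u k).

(** The class read as a polynomial in [U], truncated below [U^V]: up to the nonzero constant
    [u0 *m phi], entry [k] is the tower coefficient in degree [-2k]. *)
Definition tower_coef (z : subm (cycles d (Cminus0 C))) : 'rV[FF]_V :=
  \row_k (component (- (2%:Z * (nat_of_ord k)%:Z)) (val z) *m phi) 0 0.

Lemma tower_coefE z k : tower_coef z 0 k =
  (component (- (2%:Z * (nat_of_ord k)%:Z)) (val z) *m phi) 0 0.
Proof. by rewrite mxE. Qed.

Lemma tower_coef_is_linear : linear tower_coef.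
Proof.
move=> a x y; apply/rowP=> k.
rewrite [RHS]mxE [X in _ = X + _]mxE !tower_coefE [val _]linearP linearP /=.
by rewrite mulmxDl -scalemxAl mxE [X in X + _]mxE.
Qed.
HB.instance Definition _ := GRing.isLinear.Build FF _ _ *:%R tower_coef
  tower_coef_is_linear.

Lemma cycle_component z delta : (cycles d (Cminus0 C)) z ->
  component delta z *m dcoef C = 0.
Proof. by case=> _ dz; rewrite -component_diff dz linear0. Qed.

Lemma inclusion_cycle delta u : u *m dcoef C = 0 -> even_supported delta u ->
  (cycles d (Cminus0 C)) (inclusion delta u).
Proof.
move=> uc su; split; first exact: inclusion_Cminus0.
by rewrite inclusion_diff // uc linear0.
Qed.

(** With [gr_w = delta + 2a], the inequality in [XE] becomes a lower bound on [n gr_w - m A]. *)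
Lemma below_lineP delta u i : even_supported delta u -> u 0 i != 0 ->
  X (- (slot delta i)%:Z) (- ((slot delta i)%:Z - alexander i)) =
  (n%:Z * delta - S <= twt m n i).
Proof.
move=> su /su fi; rewrite (@XE _ _ i); last first.
  exact: (slot_basis_alexander delta i).
by rewrite /twt (fits_slot fi); apply/idP/idP; lia.
Qed.

Lemma region_component z delta i :
  Cregion C X z -> component delta z 0 i != 0 ->
  n%:Z * delta - S <= twt m n i.
Proof.
move=> zX /component_neq0 [a [b [/zX[_ Xab] deg al]]].
by move: Xab; rewrite (XE al) /twt -deg; lia.
Qed.

Lemma tower_coef_surj w : exists z, tower_coef z = w.
Proof.
pose c0 := (u0 *m phi) 0 0.
pose x := \sum_(k < V)
  (w 0 k / c0) *: inclusion (- (2%:Z * (nat_of_ord k)%:Z)) u0.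
have su k : even_supported (- (2%:Z * k%:Z)) u0.
  by rewrite -[- _]add0r; apply: supported_shift.
have xP : submod_mem (cycles d (Cminus0 C)) x.
  apply/rpred_sum => k _; apply/rpredZ/asboolP.
  exact: inclusion_cycle.
exists (Sub x xP); apply/rowP=> k.
rewrite tower_coefE SubK /x linear_sum mulmx_suml summxE.
rewrite (bigD1 k) //= big1 ?addr0 => [|k' ne]; last first.
  rewrite linearZ_LR component_inclusion //; case: eqP => [/= E|_].
    by case/eqP: ne; apply/val_inj => /=; lia.
  by rewrite scaler0 mul0mx mxE.
rewrite linearZ_LR component_inclusion // eqxx -scalemxAl mxE.
by rewrite mulfVK.
Qed.

(** Either [u] bounds, or its degree is [-2k] with [k >= V] and it is homologous to a multiple of
    [U^(k - V)] times the cycle attaining [V], which lies in the region. *)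
Lemma split_component delta u : u *m dcoef C = 0 -> even_supported delta u ->
  (forall k, (k < V)%N -> delta = - (2%:Z * k%:Z) -> (u *m phi) 0 0 = 0) ->
  exists z y, [/\ cycles d (Cminus0 C) z, Cregion C X z, Cminus0 C y &
    inclusion delta u = z + d y].
Proof.
move=> uc su u_phi; have [l [y [uE sy hl]]] := u0_gen uc su.
have incY y' : even_supported (delta + 1) y' ->
    d (inclusion (delta + 1) y') = inclusion delta (y' *m dcoef C).
  by move=> sy'; rewrite inclusion_diff // addrK.
have [l0|l_neq0] := eqVneq l 0.
  exists 0, (inclusion (delta + 1) y); split; try exact: submod0.
    exact: inclusion_Cminus0.
  by rewrite add0r incY // uE l0 scale0r add0r.
(* A tower part in degree [-2k] with [k < V] would be seen by [phi]. *)
have [k dE] := hl l_neq0; have le_Vk : (V <= k)%N.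
  rewrite leqNgt; apply/negP=> /u_phi/(_ dE)/eqP.
  rewrite uE mulmxDl -mulmxA phi_bnd mulmx0 addr0 -scalemxAl mxE mulf_eq0.
  by rewrite (negbTE l_neq0) (negbTE phi_u0).
have [uV [uVc uVb suV uVX]] := V_attained.
have [lV [yV [uVE syV _]]] := u0_gen uVc suV.
have lV_neq0 : lV != 0.
  by apply: contraNneq uVb => lV0; rewrite uVE lV0 scale0r add0r submxMl.
have dV : delta = - (2%:Z * V%:Z) - 2%:Z * (k - V)%N%:Z.
  by rewrite dE -subzn //; ring.
have suV' : even_supported delta uV by rewrite dV; apply: supported_shift.
have sy' : even_supported (delta + 1) (- (l / lV) *: yV + y).
  apply: supportedP => //; rewrite dV addrAC; exact: supported_shift.
exists (inclusion delta ((l / lV) *: uV)),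
  (inclusion (delta + 1) (- (l / lV) *: yV + y)).
have sl : even_supported delta ((l / lV) *: uV).
  move=> i; rewrite mxE mulf_eq0 negb_or => /andP[_]; exact: suV'.
split.
- by apply: inclusion_cycle; rewrite // -scalemxAl uVc scaler0.
- apply: inclusion_span => i ui; split; first exact: slot_basis_alexander.
  rewrite /slot_basis (below_lineP sl ui).
  (* Since [k >= V], the bound for [uV] at level [V] implies the weaker one at level [k]. *)
  have := uVX i; move: ui; rewrite mxE mulf_eq0 negb_or => /andP[_ ui] /(_ ui).
  by rewrite dE; nia.
- exact: inclusion_Cminus0.
rewrite incY // -linearD; congr (inclusion _ _).
rewrite mulmxDl -scalemxAl uVE uE scaleNr scalerDr scalerA divfK //.
by rewrite addrA addrK.
Qed.

(** One direction splits the cycle into homogeneous components. Conversely, by minimality of [V], a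
    cycle of the region has bounding components in degrees [-2k] with [k < V], and [phi] kills
    them. *)
Lemma tower_coef_eq0 z : tower_coef z = 0 <->
  exists z' y, [/\ cycles d (Cminus0 C) z', Cregion C X z', Cminus0 C y &
    val z = z' + d y].
Proof.
have /asboolP zC := valP z; split=> [z0|[z' [y [z'C z'X _ zE]]]].
  have [s ->] := component_decomposition zC.1; apply: (big_ind (fun x =>
      exists z' y, [/\ cycles d (Cminus0 C) z', Cregion C X z', Cminus0 C y &
        x = z' + d y])).
  - by exists 0, 0; split; try exact: submod0; rewrite linear0 addr0.
  - move=> x1 x2 [z1 [y1 [z1C z1X y1C ->]]] [z2 [y2 [z2C z2X y2C ->]]].
    exists (1 *: z1 + z2), (1 *: y1 + y2); split; try exact: submodPZ.
    by rewrite !scale1r linearD addrACA.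
  move=> delta _; apply: split_component.
  - exact: cycle_component.
  - exact: component_supported.
  move=> k lt_k dE; have /rowP/(_ (Ordinal lt_k)) := z0.
  by rewrite tower_coefE /= -dE => ->; rewrite mxE.
apply/rowP=> k; rewrite tower_coefE zE linearD mulmxDl mxE [RHS]mxE.
have -> : component (- (2%:Z * (nat_of_ord k)%:Z)) (d y) *m phi = 0.
  by rewrite -[- _](addrK 1) component_diff -mulmxA phi_bnd mulmx0.
rewrite [X in _ + X]mxE addr0; set u := component _ _.
have uc : u *m dcoef C = 0 by exact: cycle_component.
have su : even_supported (- (2%:Z * (nat_of_ord k)%:Z)) u.
  exact: component_supported.
have [ub|nb] := boolP (u <= dcoef C)%MS.
  by have /submxP[v ->] := ub; rewrite -mulmxA phi_bnd mulmx0 mxE.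
case: (V_min (ltn_ord k)); exists u; split=> // i /(region_component z'X).
by lia.
Qed.

(** [tower_coef] descends to homology, where its kernel is the image of the homology of the region;
    surjectivity then gives dimension [V]. *)
Lemma is_V_below_line : is_V C X V.
Proof.
have [|hf hfE] := @quotm_lift _ _ _ (boundaries d (Cminus0 C)) tower_coef.
  move=> z [y y0 zE]; apply/tower_coef_eq0; exists 0, y.
  by split; try exact: submod0; rewrite ?add0r.
apply: (@quotm_iso _ _ _ (induced_image d (Cregion C X) (Cminus0 C)) hf);
  last first.
  by move=> w; have [z <-] := tower_coef_surj w; exists (hclass z); apply: hfE.
elim/quotm_ind=> z; rewrite hfE; apply: iff_trans (tower_coef_eq0 z) _.
split=> [[z' [y [z'C z'X y0 zE]]]|[z' z'X zz']].
  have z'P : submod_mem (cycles d (Cminus0 C)) z' by exact/asboolP.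
  exists (Sub z' z'P); first by rewrite SubK.
  apply/quotm_classP; exists y => //.
  by rewrite linearB /= zE addrC addKr.
have [y y0 zE] := (quotm_classP _ _ _).1 zz'.
exists (val z'), y; split=> //; first exact/asboolP/(valP z').
by rewrite -zE linearB addrC subrK.
Qed.

End Cokernel.
End Components.

(** * The least level of a non-bounding cycle *)

Section MinimalLevel.
Variables (C : bicomplex) (m n : nat).
(** For a knot-like complex this is [V_SC(m/n, S/2n)], by [is_V_least_level]. *)
Definition least_level (S : int) (V : nat) :=
  (exists u, below_line (C := C) m n S u V) /\
  forall k, (exists u, below_line (C := C) m n S u k) -> (V <= k)%N.

(** For [m] even, [n gr_w - m A] is even on generators of even [gr_w], so an odd lower bound may be
    raised by one. *)
Lemma least_level_odd S V V' : ~~ odd m ->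
  least_level (2%:Z * S) V -> least_level (2%:Z * S + 1) V' -> (V <= V')%N.
Proof.
move=> m_even [_ V_min] [[u [uc nb su uT]] _]; apply: V_min.
exists u; split=> // i ui; have := uT i ui; have /fits_slot := su i ui.
rewrite /twt -(odd_double_half m) (negbTE m_even) add0n -mul2n PoszM.
move=> ->; set x := alexander i; set y := (slot _ _ _ _)%:Z.
have -> : n%:Z * (- (2%:Z * V'%:Z) + 2%:Z * y) - 2%:Z * (m./2)%:Z * x =
  2%:Z * (n%:Z * (- V'%:Z + y) - (m./2)%:Z * x) by ring.
rewrite -[2%:Z * n%:Z * _]mulrA.
move: (n%:Z * _ - _) (n%:Z * V'%:Z) => p q; lia.
Qed.

Hypotheses (hC : knot_like C) (hn : (0 < n)%N).

Lemma least_level_exists S : exists V, least_level S V.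
Proof.
have [u0 [u0c u0b su0 _]] := vertical_generator hC.
pose P k := `[< exists u, below_line (C := C) m n S u k >].
have exP : exists k, P k.
  (* At this level the bound holds on every generator, because [S + 2n(T + |S|) >= T]. *)
  pose T := (\sum_(i < rk C) `|twt m n i : int|)%N; exists (T + `|S|)%N.
  apply/asboolP; exists u0; split=> //.
    by rewrite -[- _]add0r; apply: supported_shift.
  move=> i _; have : (`|twt m n i : int| <= T)%N.
    by rewrite /T (bigD1 i) //= leq_addr.
  by rewrite PoszD; nia.
case: (ex_minnP exP) => V /asboolP V_at V_min; exists V; split=> // k hk.
by apply: V_min; apply/asboolP.
Qed.

Hypothesis hm : (0 < m)%N.

Lemma SC_lattice (S : int) (a : nat) (b : int) (i : 'I_(rk C)) :
  Cminus_alexander (a, b, i) = 0 ->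
  SC (m%:R / n%:R) (S%:~R / (2 * n)%:R) (- a%:Z) (- b) =
  (m%:Z * alexander i <= 2%:Z * n%:Z * a%:Z + S).
Proof.
rewrite /Cminus_alexander => al.
have m0 : 0 < m%:R :> rat by rewrite ltr0n.
have m_neq0 : m%:R != 0 :> rat by rewrite lt0r_neq0.
have n_neq0 : n%:R != 0 :> rat by rewrite pnatr_eq0 -lt0n.
have -> : b = a%:Z - alexander i by lia.
rewrite /SC -(ler_pM2r m0) -(ler_int rat) natrM.
rewrite !(intrD, intrM, intrN) -!pmulrn.
rewrite -[LHS]subr_ge0 -[RHS]subr_ge0; congr (0 <= _).
by field; rewrite m_neq0 n_neq0.
Qed.

Lemma is_V_least_level S V : least_level S V ->
  is_V C (SC (m%:R / n%:R) (S%:~R / (2 * n)%:R)) V.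
Proof.
case=> V_at V_min; have [u0 [u0c u0b su0 u0_gen]] := vertical_generator hC.
(* A column of the cokernel matrix kills boundaries; one is chosen that does not kill [u0]. *)
have [j u0j] : exists j, (u0 *m cokermx (dcoef C)) 0 j != 0.
  by move: u0b; rewrite submxE => /rV0Pn.
pose phi := cokermx (dcoef C) *m delta_mx j (0 : 'I_1).
have phi_bnd : dcoef C *m phi = 0 by rewrite mulmxA mulmx_coker mul0mx.
have phi_u0 : (u0 *m phi) 0 0 != 0 by rewrite mulmxA -colE mxE.
apply: (is_V_below_line u0c su0 u0_gen _ phi_bnd phi_u0 V_at).
  exact: SC_lattice.
by move=> k lt_k /V_min; rewrite leqNgt lt_k.
Qed.

(** The witness has [n gr_t >= -(S + 2nV)], and [-(S + 2nV)/n = -2(S/2n + V)]. *)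
Lemma least_level_tower S V : (m <= 2 * n)%N -> least_level S V ->
  tower_degree C m n (- 2 * (S%:~R / (2 * n)%:R + V%:R)).
Proof.
move=> hmn [[u [uc nb _ uT]] _]; apply/tower_degreeP => //.
exists (- (S + 2%:Z * n%:Z * V%:Z)), u; split=> //.
have n_neq0 : n%:R != 0 :> rat by rewrite pnatr_eq0 -lt0n.
rewrite natrM !(intrD, intrM, intrN) -!pmulrn.
by field; rewrite n_neq0.
Qed.

End MinimalLevel.

(** * The formula for Upsilon *)

Lemma tower_degree_le (C : bicomplex) (m n : nat) (s0 : int) q :
  knot_like C -> (0 < n)%N -> (m <= 2 * n)%N ->
  (forall i : 'I_(rk C), 2%:Z * n%:Z * s0 <= m%:Z * alexander i) ->
  tower_degree C m n q ->
  exists i k u, [/\ (i < 2 * n)%N,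
    below_line (C := C) m n (2%:Z * n%:Z * s0 + i%:Z) u k &
    q = - 2 * ((2%:Z * n%:Z * s0 + i%:Z)%:~R / (2 * n)%:R + k%:R)].
Proof.
move=> hC hn hmn hs0 /tower_degreeP [] // Q [u [-> uc nb uQ]].
have [vc vb] := even_part_cycle hC uc nb.
set v := congruent_part _ _ _ _ in vc vb.
have vE i : v 0 i != 0 -> (2 %| grw i)%Z /\ Q <= twt m n i.
  by rewrite mxE subr0; case: ifP => [d2 /uQ //|]; rewrite eqxx.
(* Division of [N] by [2n] yields the level as quotient and the index [i] as remainder, so that
   [-Q = 2n s0 + i + 2nK]. *)
pose N : int := - Q - 2%:Z * n%:Z * s0.
have n2_gt0 : (0 : int) < (2 * n)%N by lia.
have NE := divz_eq N (2 * n)%N; have i_ge0 := modz_ge0 N (lt0r_neq0 n2_gt0).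
have i_lt := ltz_pmod N n2_gt0.
move: NE i_ge0 i_lt; set K := (N %/ _)%Z; case: (N %% _)%Z => // i NE _ i_lt.
(* On the support, [n gr_w = twt + m A >= Q + 2n s0 > -2n(K + 1)]; as [gr_w] is even there, it is at
   least [-2K]. *)
have sv : supported (@grw C) 2 (- (2%:Z * K)) v.
  move=> j /vE[/dvdzP[w wE]]; rewrite /twt wE => QT.
  have s0j := hs0 j; have wK : 0 < n%:Z * (w + K + 1).
    by move: NE QT s0j i_lt; rewrite /N PoszM; lia.
  have {}wK : - K <= w by move: wK; rewrite pmulr_rgt0; lia.
  have [|//] := @fitsP _ (@grw C) 2 isT (- (2%:Z * K)) j `|(w + K)%R|%N.
  by rewrite wE gez0_abs ?(mulrC w); [ring | lia].
(* For [K < 0] the cycle would have positive degree and hence bound. *)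
case: K NE sv => [k NE sv|k NE sv]; last first.
  by case/negP: vb; apply: (odd_cycle_boundary hC vc sv) => k'; lia.
exists i, k, v; split; [by [] | split=> // j /vE[_ QT] | ].
  by move: NE; rewrite /N PoszM; lia.
have -> : Q = - (2%:Z * n%:Z * s0 + i%:Z + 2%:Z * n%:Z * k%:Z).
  by move: NE; rewrite /N PoszM; lia.
have n_neq0 : n%:R != 0 :> rat by rewrite pnatr_eq0 -lt0n.
rewrite natrM !(intrD, intrM, intrN) -!pmulrn.
by field; rewrite n_neq0.
Qed.

Theorem proposition39 (C : bicomplex) (hC : knot_like C)
    (m n : nat) (hm : (0 < m)%N) (hn : (0 < n)%N) (hmn : (m <= 2 * n)%N)
    (t : rat) (ht : t = m%:R / n%:R)
    (s0 : int)
    (hs0 : s0%:~R < - (t / 2) * (max_alexander C)%:~R - 1)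
    (hs0' : forall i : 'I_(rk C), s0%:~R <= t / 2 * (alexander i)%:~R)
    (s : nat -> rat) (hs : forall i, s i = s0%:~R + i%:R / (2 * n)%:R) :
  exists V : nat -> nat,
    [/\ forall i, (i < 2 * n)%N -> is_V C (SC t (s i)) (V i),
        is_Upsilon C m n
          (- 2 * \big[Order.min/s 0%N + (V 0%N)%:R]_(i < 2 * n)
                  (s i + (V i)%:R)) &
        ~~ odd m ->
        is_Upsilon C m n
          (- 2 * \big[Order.min/s 0%N + (V 0%N)%:R]_(i < 2 * n | ~~ odd i)
                  (s i + (V i)%:R))].
Proof.
have n_neq0 : n%:R != 0 :> rat by rewrite pnatr_eq0 -lt0n.
pose S i : int := 2%:Z * n%:Z * s0 + i%:Z.
have sE i : s i = (S i)%:~R / (2 * n)%:R.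
  rewrite hs /S natrM !(intrD, intrM) -!pmulrn.
  by field; rewrite n_neq0.
have [V VP] := choice (fun i => least_level_exists m hC hn (S i)).
have s0_le (i : 'I_(rk C)) : 2%:Z * n%:Z * s0 <= m%:Z * alexander i.
  have n2_gt0 : 0 < 2 * n%:R :> rat by rewrite mulr_gt0 // ltr0n.
  have := hs0' i; rewrite ht -(ler_pM2l n2_gt0) -(ler_int rat).
  rewrite !intrM -!pmulrn; congr (_ <= _); by field.
have towV i : tower_degree C m n (- 2 * (s i + (V i)%:R)).
  by rewrite sE; apply: least_level_tower (VP i).
(* Every term gives a tower degree, so a minimum over [P] computes Upsilon once each tower degree is
   dominated by a term with index in [P]. *)
have bound (P : pred nat) :
    (forall q, tower_degree C m n q ->
       exists i, [/\ (i < 2 * n)%N, P i & q <= - 2 * (s i + (V i)%:R)]) ->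
    is_Upsilon C m n (- 2 * \big[Order.min/s 0%N + (V 0%N)%:R]_(i < 2 * n | P i)
                  (s i + (V i)%:R)).
  move=> Pq; split.
    (* The default value of the minimum is the term for [i = 0], so it too gives a tower degree. *)
    apply: (big_ind (fun x => tower_degree C m n (- 2 * x))) => // x y hx hy.
    by rewrite /Order.min; case: ifP.
  move=> q /Pq[i [lt_i Pi q_le]]; apply: le_trans q_le _.
  rewrite ler_nM2l //; exact: (@bigmin_le_cond _ _ _ _ (Ordinal lt_i)).
have tow_le q : tower_degree C m n q ->
    exists2 i, (i < 2 * n)%N & q <= - 2 * (s i + (V i)%:R).
  case/(tower_degree_le hC hn hmn s0_le) => i [k [u [lt_i uk ->]]].
  exists i => //; rewrite -/(S i) -sE ler_nM2l // lerD2l ler_nat.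
  by apply: (VP i).2; exists u.
exists V; split=> [i _||m_even].
- by rewrite sE ht; apply: is_V_least_level (VP i).
- apply: (bound predT) => q /tow_le[i lt_i q_le]; by exists i.
apply: (bound (fun i => ~~ odd i)) => q /tow_le[i lt_i q_le].
have [i_odd|] := boolP (odd i); last by exists i.
(* Passing from an odd index to its predecessor lowers [s] and does not raise [V]. *)
case: i i_odd lt_i q_le => // i /= i_even lt_i q_le.
exists i; split=> //; first exact: ltnW.
apply: le_trans q_le _; rewrite ler_nM2l //; apply: lerD.
  rewrite !hs lerD2l ler_pM2r ?ler_nat // invr_gt0 ltr0n; lia.
rewrite ler_nat; apply: (least_level_odd (S := n%:Z * s0 + (i./2)%:Z) m_even).
  suff <- : S i = 2%:Z * (n%:Z * s0 + (i./2)%:Z) by [].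
  by rewrite /S; lia.
suff <- : S i.+1 = 2%:Z * (n%:Z * s0 + (i./2)%:Z) + 1 by [].
by rewrite /S; lia.
Qed.
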